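(* Let $F$ be a field and let $L$ be a cyclic Leibniz algebra of type (I) over $F$, of dimension $n$. Then the automorphism group $\mathbf{Aut}_{[,]}(L)$ is a semidirect product of a normal subgroup $U\cong\mathbf{I}(F[X]/R(n))$ and a subgroup $D\cong\mathbf{U}(F)$.
   Context: A (left) Leibniz algebra over a field $F$ is an $F$-vector space $L$ with a bilinear operation $[,]$ satisfying $[[a,b],c]=[a,[b,c]]-[b,[a,c]]$ for all $a,b,c\in L$. An endomorphism of $L$ is a linear transformation $f$ of $L$ with $f([a,b])=[f(a),f(b)]$ for all $a,b$; an automorphism is a bijective endomorphism; $\mathbf{Aut}_{[,]}(L)$ is the group of all automorphisms of $L$ under composition. A Leibniz algebra is cyclic if it is generated by one element $a$. A finite-dimensional cyclic Leibniz algebra $L=\langle a\rangle$ has a basis $a_1,\ldots,a_n$ with $a_1=a$, $a_2=[a_1,a_1]$, $\ldots$, $a_n=[a_1,a_{n-1}]$ and $[a_1,a_n]=\alpha_2a_2+\ldots+\alpha_na_n$ for some $\alpha_i\in F$; moreover $[L,L]=Fa_2+\ldots+Fa_n$, and $[a_j,y]=0$ for all $j\geqslant 2$ and $y\in L$. $L$ is of type (I) if $[a_1,a_n]=0$. $\mathbf{U}(R)$ denotes the group of units of a ring $R$; in particular $\mathbf{U}(F)$ is the multiplicative group of $F$. $R(n)$ denotes the ideal of the polynomial ring $F[X]$ generated by $X^n$, and $z=X+R(n)$. $\mathbf{I}(F[X]/R(n))$ is the subgroup $\{1+\alpha_1z+\alpha_2z^2+\ldots+\alpha_{n-1}z^{n-1}\mid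 \alpha_1,\ldots,\alpha_{n-1}\in F\}$ of $\mathbf{U}(F[X]/R(n))$. *)

(* Defs.v *)
From HB Require Import structures.
From mathcomp Require Import all_boot all_order all_algebra.
From mathcomp Require Import boolp.

Set Implicit Arguments.
Unset Strict Implicit.
Unset Printing Implicit Defensive.

Import GRing.Theory.
Local Open Scope ring_scope.

HB.mixin Record isLeibniz (F : fieldType) L of Vector F L := {
  lbracket : L -> L -> L;
  lbracket_linearl : forall b, linear (lbracket^~ b);
  lbracket_linearr : forall a, linear (lbracket a);
  lbracket_leibniz : forall a b c,
    lbracket (lbracket a b) c =
      lbracket a (lbracket b c) - lbracket b (lbracket a c)
}.

#[short(type="leibnizAlgType")]
HB.structure Definition Leibniz (F : fieldType) :=
  {L of isLeibniz F L & Vector F L}.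

Section Cyclic.
Context {F : fieldType} {L : leibnizAlgType F}.

Definition lsubalgebra (V : {vspace L}) : Prop :=
  forall x y, x \in V -> y \in V -> lbracket x y \in V.

Definition lgenerates (a : L) : Prop :=
  forall V : {vspace L}, lsubalgebra V -> a \in V -> V = fullv.

(* lpow a k is a_k, with a_1 = a and a_(k+1) = [a_1, a_k]; the index 0 is a   *)
(* junk value.                                                                *)
Definition lpow (a : L) (k : nat) : L := iter k.-1 (lbracket a) a.

End Cyclic.

(* When a generates L and n = dim L > 0, a_1, .., a_n is a basis of L.        *)
Definition cyclic_typeI (F : fieldType) (L : leibnizAlgType F) : Prop :=
  exists2 a : L, lgenerates a & lbracket a (lpow a (\dim {:L})) = 0.

Section Automorphisms.
Context {F : fieldType} {L : leibnizAlgType F}.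

Definition is_leib_aut (f : 'End(L)) : Prop :=
  bijective f /\ {morph f : x y / lbracket x y}.

Record leib_aut : Type :=
  LeibAut { leib_aut_val :> 'End(L); _ : `[< is_leib_aut leib_aut_val >] }.

HB.instance Definition _ := [isSub for leib_aut_val].
HB.instance Definition _ := [Choice of leib_aut by <:].

Lemma leib_autP (f : leib_aut) : is_leib_aut f.
Proof. exact/asboolP/(valP f). Qed.

Fact leib_aut_one_subproof : `[< is_leib_aut \1%VF >].
Proof.
apply/asboolP; split; last by move=> x y; rewrite !id_lfunE.
by exists id => x; rewrite id_lfunE.
Qed.
Definition leib_aut_one := LeibAut leib_aut_one_subproof.

Fact leib_aut_mul_subproof (f g : leib_aut) : `[< is_leib_aut (f \o g)%VF >].
Proof.
have [[f' fK f'K] fM] := leib_autP f; have [[g' gK g'K] gM] := leib_autP g.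
apply/asboolP; split; last by move=> x y; rewrite !comp_lfunE gM fM.
by exists (g' \o f') => x /=; rewrite comp_lfunE /= ?fK ?gK // g'K f'K.
Qed.
Definition leib_aut_mul f g := LeibAut (leib_aut_mul_subproof f g).

Lemma leib_autK (f : leib_aut) : cancel f (f^-1)%VF.
Proof.
have [/bij_inj f_inj _] := leib_autP f.
by move=> x; apply: lker0_lfunK; apply/lker0P.
Qed.

Lemma leib_autVK (f : leib_aut) : cancel (f^-1)%VF f.
Proof. by have [fbij _] := leib_autP f; apply/(bij_can_sym fbij)/leib_autK. Qed.

Fact leib_aut_inv_subproof (f : leib_aut) : `[< is_leib_aut (f^-1)%VF >].
Proof.
apply/asboolP; split; first by exists f; [apply: leib_autVK|apply: leib_autK].
move=> x y; have [_ fM] := leib_autP f.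
by apply: (can_inj (leib_autK f)); rewrite fM !leib_autVK.
Qed.
Definition leib_aut_inv f := LeibAut (leib_aut_inv_subproof f).

Fact leib_aut_mulA : associative leib_aut_mul.
Proof. by move=> f g h; apply/val_inj; rewrite /= comp_lfunA. Qed.
Fact leib_aut_mul1 : left_id leib_aut_one leib_aut_mul.
Proof. by move=> f; apply/val_inj; rewrite /= comp_lfun1l. Qed.
Fact leib_aut_mulr1 : right_id leib_aut_one leib_aut_mul.
Proof. by move=> f; apply/val_inj; rewrite /= comp_lfun1r. Qed.
Fact leib_aut_mulV : left_inverse leib_aut_one leib_aut_inv leib_aut_mul.
Proof.
move=> f; apply/val_inj/lfunP=> x /=.
by rewrite comp_lfunE id_lfunE leib_autK.
Qed.
Fact leib_aut_mulrV : right_inverse leib_aut_one leib_aut_inv leib_aut_mul.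
Proof.
move=> f; apply/val_inj/lfunP=> x /=.
by rewrite comp_lfunE id_lfunE leib_autVK.
Qed.

HB.instance Definition _ := isGroup.Build leib_aut
  leib_aut_mulA leib_aut_mul1 leib_aut_mulr1 leib_aut_mulV leib_aut_mulrV.

End Automorphisms.

Arguments leib_aut {F} L.

(* The library's {unit R} is restricted to finite rings.                      *)
Section UnitGroup.
Context {R : unitRingType}.

Record runit : Type := RUnit { runit_val : R; _ : runit_val \is a GRing.unit }.

HB.instance Definition _ := [isSub for runit_val].
HB.instance Definition _ := [Choice of runit by <:].

Fact runit_mul_subproof (x y : runit) : runit_val x * runit_val y \is a GRing.unit.
Proof. by apply: rpredM; apply: valP. Qed.
Definition runit_mul x y := RUnit (runit_mul_subproof x y).

Fact runit_inv_subproof (x : runit) : (runit_val x)^-1 \is a GRing.unit.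
Proof. by rewrite unitrV; apply: valP. Qed.
Definition runit_inv x := RUnit (runit_inv_subproof x).

Definition runit_one := RUnit (unitr1 R).

Fact runit_mulA : associative runit_mul.
Proof. by move=> x y z; apply/val_inj; rewrite /= mulrA. Qed.
Fact runit_mul1 : left_id runit_one runit_mul.
Proof. by move=> x; apply/val_inj; rewrite /= mul1r. Qed.
Fact runit_mulr1 : right_id runit_one runit_mul.
Proof. by move=> x; apply/val_inj; rewrite /= mulr1. Qed.
Fact runit_mulV : left_inverse runit_one runit_inv runit_mul.
Proof. by move=> x; apply/val_inj; rewrite /= mulVr // (valP x). Qed.
Fact runit_mulrV : right_inverse runit_one runit_inv runit_mul.
Proof. by move=> x; apply/val_inj; rewrite /= divrr // (valP x). Qed.

HB.instance Definition _ := isGroup.Build runit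
  runit_mulA runit_mul1 runit_mulr1 runit_mulV runit_mulrV.

End UnitGroup.

Arguments runit R : clear implicits.

(* {poly %/ 'X^n} is F[X]/(X^n) only for n > 0: for n = 0 the library         *)
(* quotients by 'X instead.                                                   *)
Definition Igroup (F : fieldType) (n : nat) :
    {pred runit {poly %/ ('X^n : {poly F})}} :=
  fun u => `[< exists alpha : nat -> F,
    runit_val u = 1 + \sum_(1 <= i < n) alpha i *: 'qX ^+ i >].

Section SemidirectProduct.
Local Open Scope group_scope.

Definition normal_subgroup (G : groupType) (N : {pred G}) : Prop :=
  group_closed N /\ forall x g : G, x \in N -> x ^ g \in N.

Definition is_sdprod (G : groupType) (N H : {pred G}) : Prop :=
  [/\ normal_subgroup N, group_closed H,
      forall x, x \in N -> x \in H -> x = 1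
    & forall g, exists x y, [/\ x \in N, y \in H & g = x * y]].

Definition subgroup_iso (G H : groupType) (A : {pred G}) (B : {pred H}) : Prop :=
  exists f : G -> H,
    [/\ {in A &, {morph f : x y / x * y}}, {in A, forall x, f x \in B},
        {in A &, injective f} & {in B, forall y, exists2 x, x \in A & f x = y}].

End SemidirectProduct.

(* Main.v *)
Require Import Defs.
From HB Require Import structures.
From mathcomp Require Import all_boot all_order all_algebra.
From mathcomp Require Import boolp.
Import GRing.Theory.
Local Open Scope ring_scope.

(** Write [N] for the left multiplication by the generator [a], and [z] for the
class of [X]. The iterates [N^i a] with [i > 0] multiply everything on their
right to zero ([lbracket_powl]), so the bracket of [x] and [y] is
[eps x *: N y], where [eps x] is the [a]-coordinate of [x] ([lbracketE]); and
type (I) says that [N] is nilpotent with cyclic vector [a]. So, as a vector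
space with the operator [N], [L] is [A = F[X]/(X^n)] with multiplication by
[z], and [a] corresponds to [1]; the two inverse isomorphisms are [to_qpoly]
and [of_qpoly].

An automorphism [f] satisfies [f \o N = chi f *: (N \o f)] with
[chi f = eps (f a)], and [chi] is a group morphism from the automorphisms to
the units of [F] ([chiM]). Its kernel is the normal subgroup [U]: these [f]
commute with [N], hence are [A]-linear, i.e. they are the multiplications by
[f a] ([aut_mulE]), where [f a] is a unit of [A] with constant term 1;
conversely each such unit gives an automorphism ([mul_aut_ex]). The
automorphisms that preserve the line [F a] form the complement [D], because
the morphism [chi] restricted to them is injective (an automorphism is
determined by its value at [a]) and onto: [c] is the image of the scaling
[N^i a |-> c^(i+1) N^i a] ([scale_aut_ex]). *)

Set Implicit Arguments.
Unset Strict Implicit.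
Unset Printing Implicit Defensive.

(** * Automorphisms of a Leibniz algebra *)

Section Automorphisms.
Context {F : fieldType} {L : leibnizAlgType F}.
Implicit Types f g : leib_aut L.

HB.instance Definition _ (a : L) :=
  GRing.isLinear.Build F L L _ (lbracket a) (lbracket_linearr a).

Lemma lbracketDZl c (x y z : L) :
  lbracket (c *: x + y) z = c *: lbracket x z + lbracket y z.
Proof. exact: lbracket_linearl. Qed.

Lemma lbracketZl c (x z : L) : lbracket (c *: x) z = c *: lbracket x z.
Proof.
have l0 : lbracket 0 z = 0.
  by have := lbracketDZl (-1) 0 0 z; rewrite scaler0 addr0 scaleN1r addNr.
by rewrite -[c *: x]addr0 lbracketDZl l0 addr0.
Qed.

Lemma leib_aut_bracket f x y : f (lbracket x y) = lbracket (f x) (f y).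
Proof. by have [_ ->] := leib_autP f. Qed.

Lemma leib_aut1E x : (1%g : leib_aut L) x = x.
Proof. by rewrite [LHS]id_lfunE. Qed.

Lemma leib_autME f g x : (f * g)%g x = f (g x).
Proof. by rewrite [LHS]comp_lfunE. Qed.

Lemma eq_leib_aut f g : f =1 g -> f = g.
Proof. by move=> fg; apply/val_inj/lfunP. Qed.

(** In finite dimension an injective endomorphism is already bijective. *)
Lemma leib_aut_ex (f : L -> L) :
    linear f -> (forall x, f x = 0 -> x = 0) ->
    {morph f : x y / lbracket x y} ->
  exists g : leib_aut L, g =1 f.
Proof.
move=> lin_f ker_f fM.
pose fL : {linear L -> L} := HB.pack f (GRing.isLinear.Build _ _ _ _ f lin_f).
have gE : linfun fL =1 f by move=> x; rewrite lfunE.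
have ker0 : lker (linfun fL) == 0%VS.
  apply/eqP/vspaceP => x; rewrite memv_ker memv0 gE.
  by apply/eqP/eqP => [/ker_f|->] //; rewrite -(gE 0) linear0.
suff aut : `[< is_leib_aut (linfun fL) >] by exists (LeibAut aut).
apply/asboolP; split=> [|x y]; last by rewrite !gE fM.
exists (linfun fL)^-1%VF => x; first exact: lker0_lfunK.
by apply: limg_lfunVK; rewrite lker0_limgf ?memvf.
Qed.

End Automorphisms.

(** * The polynomial model of a cyclic algebra of type (I) *)

Section CyclicTypeI.
Context {F : fieldType} {L : leibnizAlgType F} {n : nat} {a : L}.
Hypotheses (n_gt0 : (0 < n)%N) (dimL : \dim {:L} = n).
Hypotheses (a_gen : lgenerates a) (a_nil : lbracket a (lpow a n) = 0).
Implicit Types (f g : leib_aut L) (x y : L).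

Local Notation N := (lbracket a).
Local Notation e i := (iter i N a).
Local Notation A := {poly %/ ('X^n : {poly F})}.

(** By the Leibniz identity [[a, a], y] = [a, [a, y]] - [a, [a, y]] = 0, and
the same identity propagates this to the later powers. *)
Lemma lbracket_powl i y : lbracket (e i.+1) y = 0.
Proof.
elim: i y => [|i IHi] y; first by rewrite /= lbracket_leibniz subrr.
by rewrite iterS lbracket_leibniz !IHi linear0 subrr.
Qed.

Lemma pow_ge i : (n <= i)%N -> e i = 0.
Proof.
move=> /subnK <-; rewrite iterD; have -> : e n = 0.
  by rewrite -[RHS]a_nil /lpow -iterS prednK.
by elim: (i - n)%N => //= k ->; rewrite linear0.
Qed.

(** Indices are shifted from the usual ones: entry [i] is the basis vector
[a_(i+1)], so that it corresponds to [z^i]. *)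
Definition powers : n.-tuple L := [tuple e i | i < n].

Lemma nth_powers (i : 'I_n) : powers`_i = e i.
Proof. by rewrite -tnth_nth tnth_mktuple. Qed.

Lemma mem_powers i : e i \in <<powers>>%VS.
Proof.
have [ltin|/pow_ge ->] := ltnP i n; last exact: mem0v.
by rewrite memv_span // -(nth_powers (Ordinal ltin)) mem_nth ?size_tuple.
Qed.

(** The powers span a subspace stable under [N]; as left multiplication by a
power is either [N] or zero, that subspace is a subalgebra containing [a]. *)
Lemma powers_basis : basis_of {:L} powers.
Proof.
rewrite basisEdim size_tuple dimL leqnn andbT.
suff -> : <<powers>>%VS = {:L}%VS by [].
apply: a_gen; last exact: (mem_powers 0).
move=> x y /coord_span -> /coord_span ->.
elim/big_ind: _ => [|x1 x2 Px1 Px2|i _].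
- by rewrite -[0](scale0r a) lbracketZl scale0r mem0v.
- by rewrite -[x1]scale1r lbracketDZl scale1r memvD.
rewrite lbracketZl nth_powers memvZ //.
case: (val i) => [|k]; last by rewrite lbracket_powl mem0v.
rewrite linear_sum /=; apply: memv_suml => j _.
by rewrite linearZ nth_powers memvZ // (mem_powers j.+1).
Qed.

Lemma powers_free : free powers.
Proof. exact: basis_free powers_basis. Qed.

Lemma powers_ind (P : L -> Prop) :
    (forall c x y, P x -> P y -> P (c *: x + y)) -> (forall i, P (e i)) ->
  forall y, P y.
Proof.
move=> Plin Pe y.
have P0 : P 0 by rewrite -(addNr a) -scaleN1r; apply: Plin; apply: (Pe 0%N).
rewrite [y](coord_basis powers_basis) ?memvf //.
elim/big_rec: _ => // i x _ Px.
by apply: Plin => //; rewrite nth_powers.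
Qed.

Lemma cyclic_ind (P : L -> Prop) :
    (forall c x y, P x -> P y -> P (c *: x + y)) -> P a ->
    (forall y, P y -> P (N y)) ->
  forall y, P y.
Proof. by move=> Plin Pa PN; apply: powers_ind => //; elim=> //= i /PN. Qed.

(** The coordinate along [a]. *)
Definition eps : L -> F := coord powers (Ordinal n_gt0).

HB.instance Definition _ := GRing.Linear.on eps.

Lemma eps_a : eps a = 1.
Proof.
by rewrite /eps -[a in coord _ _ a](nth_powers (Ordinal n_gt0)) coord_free
           ?powers_free.
Qed.

Lemma eps_N y : eps (N y) = 0.
Proof.
elim/powers_ind: y => [c x y Ex Ey|i].
  by rewrite !linearP /= Ex Ey mulr0 addr0.
rewrite -iterS; have [ltin|/pow_ge ->] := ltnP i.+1 n; last by rewrite linear0.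
by rewrite /eps -(nth_powers (Ordinal ltin)) coord_free ?powers_free.
Qed.

(** Only the [a]-component of the left argument acts, because a bracket
[[a, x]] acts on the left as zero. *)
Lemma lbracketE x y : lbracket x y = eps x *: N y.
Proof.
elim/cyclic_ind: x y => [c x x' Ex Ex' y||x Ex y].
- by rewrite lbracketDZl Ex Ex' linearP scalerDl scalerA.
- by move=> y; rewrite eps_a scale1r.
by rewrite lbracket_leibniz !Ex linearZ subrr eps_N scale0r.
Qed.

Lemma size_modulus : size (mk_monic ('X^n : {poly F})) = n.+1.
Proof. by rewrite mk_monic_Xn prednK // size_polyXn. Qed.

Lemma qX_exp i : 'qX ^+ i = in_qpoly 'X^n 'X^i :> A.
Proof. by rewrite [RHS]rmorphXn. Qed.

Lemma coef_qX i k : (i < n)%N -> ('qX ^+ i : A)`_k = (k == i)%:R.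
Proof.
move=> ltin; rewrite qX_exp in_qpoly_small.
  by rewrite coefXn.
by rewrite size_modulus size_polyXn.
Qed.

Lemma qX_ge i : (n <= i)%N -> 'qX ^+ i = 0 :> A.
Proof.
move=> /subnK <-; rewrite exprD (qX_exp n).
suff -> : in_qpoly 'X^n 'X^n = 0 :> A by rewrite mulr0.
apply/val_inj => /=; have := mk_monic_Xn F n; rewrite prednK // => ->.
by rewrite Pdiv.RingMonic.rmodpp ?monicXn.
Qed.

Definition to_qpoly y : A := \sum_(i < n) coord powers i y *: 'qX ^+ i.
Definition of_qpoly (q : A) : L := \sum_(i < n) q`_i *: e i.

Fact to_qpoly_is_linear : linear to_qpoly.
Proof.
move=> c x y; rewrite scaler_sumr -big_split; apply: eq_bigr => i _ /=.
by rewrite linearP scalerDl scalerA.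
Qed.
HB.instance Definition _ :=
  GRing.isLinear.Build F L A _ to_qpoly to_qpoly_is_linear.

Fact of_qpoly_is_linear : linear of_qpoly.
Proof.
move=> c p q; rewrite scaler_sumr -big_split; apply: eq_bigr => i _ /=.
by rewrite coefD coefZ scalerDl scalerA.
Qed.
HB.instance Definition _ :=
  GRing.isLinear.Build F A L _ of_qpoly of_qpoly_is_linear.

Lemma of_qpoly_qX i : of_qpoly ('qX ^+ i) = e i.
Proof.
have [ltin|lein] := ltnP i n; last by rewrite qX_ge // pow_ge // linear0.
rewrite /of_qpoly (bigD1 (Ordinal ltin)) //= coef_qX // eqxx scale1r.
rewrite big1 ?addr0 // => j ne_ji.
by rewrite coef_qX // -[val j == i]/(j == Ordinal ltin) (negPf ne_ji) scale0r.
Qed.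

Lemma of_qpoly_inj : injective of_qpoly.
Proof.
move=> p q eq_pq; apply/val_inj/polyP => k /=.
have [ltkn|lenk] := ltnP k n; last first.
  have size_le (r : A) : (size (val r) <= k)%N.
    by rewrite (leq_trans _ lenk) // -ltnS -size_modulus size_mk_monic.
  by rewrite !nth_default ?size_le.
have /(congr1 (coord powers (Ordinal ltkn))) := eq_pq.
have of_qpolyE (r : A) : of_qpoly r = \sum_(i < n) r`_i *: powers`_i.
  by apply: eq_bigr => i _; rewrite nth_powers.
by rewrite !of_qpolyE !coord_sum_free ?powers_free.
Qed.

Lemma to_qpolyK : cancel to_qpoly of_qpoly.
Proof.
move=> y; rewrite linear_sum [RHS](coord_basis powers_basis) ?memvf //.
by apply: eq_bigr => i _; rewrite linearZ /= of_qpoly_qX nth_powers.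
Qed.

Lemma of_qpolyK : cancel of_qpoly to_qpoly.
Proof. by move=> q; apply: of_qpoly_inj; rewrite to_qpolyK. Qed.

Lemma to_qpoly_pow i : to_qpoly (e i) = 'qX ^+ i.
Proof. by rewrite -of_qpoly_qX of_qpolyK. Qed.

Lemma to_qpoly_a : to_qpoly a = 1.
Proof. exact: (to_qpoly_pow 0). Qed.

Lemma of_qpoly1 : of_qpoly 1 = a.
Proof. by rewrite -to_qpoly_a to_qpolyK. Qed.

Lemma to_qpoly_N y : to_qpoly (N y) = 'qX * to_qpoly y.
Proof.
elim/powers_ind: y => [c x y Ex Ey|i]; last first.
  by rewrite -iterS !to_qpoly_pow exprS.
by rewrite !linearP /= Ex Ey mulrDr scalerAr.
Qed.

Lemma of_qpoly_mulX q : of_qpoly ('qX * q) = N (of_qpoly q).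
Proof. by rewrite -[q in LHS]of_qpolyK -to_qpoly_N to_qpolyK. Qed.

(** Read on [A], [eps] is the constant term, a ring morphism to [F]. *)
Lemma eps_mul p q :
  eps (of_qpoly (p * q)) = eps (of_qpoly p) * eps (of_qpoly q).
Proof.
rewrite -[p]of_qpolyK; elim/cyclic_ind: (of_qpoly p) => [c x y Ex Ey||y _].
- rewrite linearP mulrDl -scalerAl !linearP /= Ex Ey.
  by rewrite mulrDl mulrA.
- by rewrite to_qpoly_a mul1r of_qpoly1 eps_a mul1r.
by rewrite to_qpoly_N -mulrA !of_qpoly_mulX !eps_N mul0r.
Qed.

(** * The character of the automorphism group *)

Definition chi f : F := eps (f a).

Lemma aut_N f y : f (N y) = chi f *: N (f y).
Proof. by rewrite leib_aut_bracket lbracketE. Qed.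

Lemma eps_aut f y : eps (f y) = eps y * chi f.
Proof.
elim/cyclic_ind: y => [c x y Ex Ey||y _].
- by rewrite !linearP /= Ex Ey mulrDl mulrA.
- by rewrite eps_a mul1r.
by rewrite aut_N linearZ /= !eps_N mulr0 mul0r.
Qed.

Lemma chi1 : chi 1%g = 1.
Proof. by rewrite /chi leib_aut1E eps_a. Qed.

Lemma chiM f g : chi (f * g)%g = chi f * chi g.
Proof. by rewrite {1}/chi leib_autME eps_aut mulrC. Qed.

Lemma chiVK f : chi f^-1%g * chi f = 1.
Proof. by rewrite -chiM mulVg chi1. Qed.

Lemma chi_neq0 f : chi f != 0.
Proof.
by apply: contraTneq (oner_neq0 F) => f0; rewrite -(chiVK f) f0 mulr0 eqxx.
Qed.

Lemma chiV f : chi f^-1%g = (chi f)^-1.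
Proof. by apply: (mulIf (chi_neq0 f)); rewrite chiVK mulVf ?chi_neq0. Qed.

Lemma aut_eq f g : f a = g a -> f = g.
Proof.
move=> fga; apply: eq_leib_aut; elim/cyclic_ind => // [c x y Ex Ey|y Ey].
  by rewrite !linearP /= Ex Ey.
by rewrite !aut_N /chi fga Ey.
Qed.

(** * The kernel of the character: multiplications by unipotent units *)

Definition unipotent_auts : {pred leib_aut L} := fun f => chi f == 1.

(** Such an [f] commutes with [N], that is, with multiplication by [z], so it
is linear over [A]. *)
Lemma aut_mulE f y :
  f \in unipotent_auts -> to_qpoly (f y) = to_qpoly (f a) * to_qpoly y.
Proof.
move=> /eqP f1; elim/cyclic_ind: y => [c x y Ex Ey||y Ey].
- by rewrite !linearP /= Ex Ey mulrDr scalerAr.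
- by rewrite to_qpoly_a mulr1.
by rewrite aut_N f1 scale1r !to_qpoly_N Ey mulrCA.
Qed.

Lemma mul_aut_ex (u : A) : u \is a GRing.unit -> eps (of_qpoly u) = 1 ->
  exists2 f, f \in unipotent_auts & to_qpoly (f a) = u.
Proof.
move=> u_unit u1; pose m y := of_qpoly (u * to_qpoly y).
have m_lin : linear m.
  by move=> c x y; rewrite /m linearP mulrDr -scalerAr linearP.
have m_ker y : m y = 0 -> y = 0.
  move=> /(congr1 to_qpoly); rewrite of_qpolyK linear0 -[RHS](mulr0 u).
  by move=> /(mulrI u_unit)/(congr1 of_qpoly); rewrite to_qpolyK linear0.
have m_mor : {morph m : x y / lbracket x y}.
  move=> x y; rewrite (lbracketE x) (lbracketE (m x)) /m eps_mul u1 mul1r to_qpolyK.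
  by rewrite linearZ /= -scalerAr linearZ /= to_qpoly_N mulrCA of_qpoly_mulX.
have [f fE] := leib_aut_ex m_lin m_ker m_mor.
have fa : f a = of_qpoly u by rewrite fE /m to_qpoly_a mulr1.
by exists f; [apply/eqP; rewrite /chi fa|rewrite fa of_qpolyK].
Qed.

Lemma unipotent_auts_normal : normal_subgroup unipotent_auts.
Proof.
split; first split; first by apply/eqP/chi1.
  move=> f g /eqP f1 /eqP g1.
  by apply/eqP; rewrite chiM chiV f1 g1 mul1r invr1.
move=> f g /eqP f1; apply/eqP.
by rewrite conjgE !chiM f1 mul1r chiVK.
Qed.

(** Every class is a combination of [1, z, .., z^(n-1)], so [Igroup] is cut out
among the units by the single condition that the constant term be 1. *)
Lemma Igroup_eps (u : runit A) :
  u \in @Igroup F n <-> eps (of_qpoly (runit_val u)) = 1.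
Proof.
split=> [/asboolP[alpha ->]|u1].
  rewrite linearD linear_sum /= of_qpoly1 linearD linear_sum /= eps_a.
  rewrite big_nat big1 ?addr0 // => -[//|i] _.
  by rewrite !linearZ /= of_qpoly_qX eps_N mulr0.
apply/asboolP; set y := of_qpoly _ in u1.
pose alpha i := if insub i is Some j then coord powers j y else 0.
exists alpha; rewrite -[runit_val u]of_qpolyK -/y /to_qpoly.
transitivity (\sum_(i < n) alpha i *: 'qX ^+ i : A).
  by apply: eq_bigr => i _; rewrite /alpha valK.
rewrite -(big_mkord predT (fun i => alpha i *: ('qX ^+ i : A))) big_ltn //.
by rewrite /alpha insubT -[coord _ _ _]/(eps y) u1 scale1r.
Qed.

Lemma unipotent_auts_iso : subgroup_iso unipotent_auts (@Igroup F n).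
Proof.
have [U_group _] := unipotent_auts_normal.
pose h f : runit A := insubd runit_one (to_qpoly (f a)).
have hE f : f \in unipotent_auts -> runit_val (h f) = to_qpoly (f a).
  (* The inverse of [f a] in [A] is the value at [a] of the inverse of [f]. *)
  move=> fU; apply: insubdK; apply/unitrP; exists (to_qpoly (f^-1%g a)).
  rewrite mulrC -aut_mulE // -leib_autME mulgV leib_aut1E to_qpoly_a.
  by split.
exists h; split=> [f g fU gU|f fU|f g fU gU|u].
- apply/val_inj; rewrite /= !hE ?(group_closedM U_group) //.
  by rewrite leib_autME aut_mulE.
- by apply/Igroup_eps; rewrite hE // to_qpolyK; apply/eqP.
- move=> /(congr1 runit_val); rewrite !hE // => /(can_inj to_qpolyK).
  exact: aut_eq.
move=> /Igroup_eps /(mul_aut_ex (valP u))[f fU fu].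
by exists f => //; apply/val_inj; rewrite /= hE.
Qed.

(** * The complement: automorphisms scaling the generator *)

Definition scaling_auts : {pred leib_aut L} := fun f => f a == chi f *: a.

(** As [a] goes to [c a], the operator [N] has to go to [c N], which forces the
exponent [i + 1] on the [i]-th iterate. *)
Lemma scale_aut_ex c : c != 0 ->
  exists2 f, f \in scaling_auts & chi f = c.
Proof.
move=> c0.
have dil_ex b : {d : {linear L -> L} | forall i, d (e i) = b ^+ i.+1 *: e i}.
  pose s := [tuple b ^+ i.+1 *: e i | i < n].
  have [d dE] := linear_of_free powers s; exists d => i.
  have [ltin|/pow_ge ->] := ltnP i n; last by rewrite scaler0 linear0.
  rewrite -(nth_powers (Ordinal ltin)) -(nth_map _ 0) ?size_tuple //.
  rewrite dE ?powers_free ?size_tuple // nth_powers.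
  by rewrite -[LHS](tnth_nth 0 s (Ordinal ltin)) tnth_mktuple.
have [[d dE] [d' d'E]] := (dil_ex c, dil_ex c^-1).
have dK : cancel d d'.
  elim/powers_ind=> [b x y Ex Ey|i]; first by rewrite !linearP /= Ex Ey.
  by rewrite dE linearZ /= d'E scalerA -exprMn divff // expr1n scale1r.
have d_ker y : d y = 0 -> y = 0 by move=> dy0; rewrite -[y]dK dy0 linear0.
have da : d a = c *: a by rewrite (dE 0%N).
have dN y : d (N y) = c *: N (d y).
  elim/powers_ind: y => [b x y Ex Ey|i].
    by rewrite !linearP /= Ex Ey.
  by rewrite dE -iterS dE linearZ /= scalerA -exprS.
have d_eps y : eps (d y) = c * eps y.
  elim/cyclic_ind: y => [b x y Ex Ey||y _].
  - by rewrite !linearP /= Ex Ey mulrDr mulrCA.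
  - by rewrite da linearZ.
  by rewrite dN linearZ /= !eps_N mulr0.
have d_mor : {morph d : x y / lbracket x y}.
  by move=> x y; rewrite (lbracketE x) (lbracketE (d x)) linearZ /= dN d_eps scalerA mulrC.
have [f fE] := leib_aut_ex (linearP d) d_ker d_mor.
have chi_f : chi f = c by rewrite /chi fE da linearZ /= eps_a mulr1.
by exists f => //; apply/eqP; rewrite chi_f fE.
Qed.

Lemma scaling_auts_group : group_closed scaling_auts.
Proof.
split=> [|f g /eqP fa /eqP ga]; apply/eqP.
  by rewrite chi1 scale1r leib_aut1E.
have gVa : g^-1%g a = (chi g)^-1 *: a.
  rewrite -[RHS]leib_aut1E -(mulVg g) leib_autME linearZ /= ga scalerA.
  by rewrite mulVf ?chi_neq0 // scale1r.
by rewrite leib_autME gVa linearZ /= fa scalerA chiM chiV mulrC.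
Qed.

Lemma scaling_auts_iso : subgroup_iso scaling_auts (predT : {pred runit F}).
Proof.
pose h f : runit F := insubd runit_one (chi f).
have hE f : runit_val (h f) = chi f.
  by apply: insubdK; rewrite -topredE /= unitfE chi_neq0.
exists h; split=> // [f g _ _|f g /eqP fa /eqP ga|u _].
- by apply/val_inj; rewrite /= !hE chiM.
- move=> /(congr1 runit_val); rewrite !hE => fg.
  by apply: aut_eq; rewrite fa ga fg.
have [|f fD fu] := @scale_aut_ex (runit_val u).
  by rewrite -unitfE (valP u).
by exists f => //; apply/val_inj; rewrite /= hE.
Qed.

(** An automorphism [f] is brought into the kernel of [chi] by dividing it by
the scaling with the same character value. *)
Lemma auts_sdprod : is_sdprod unipotent_auts scaling_auts.
Proof.
split; [exact: unipotent_auts_normal|exact: scaling_auts_group| |].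
  move=> f /eqP f1 /eqP fa.
  by apply: aut_eq; rewrite fa f1 scale1r leib_aut1E.
move=> f; have [d dD chi_d] := scale_aut_ex (chi_neq0 f).
exists (f / d)%g, d; split=> //; last by rewrite divgK.
by apply/eqP; rewrite chiM chiV chi_d divff ?chi_neq0.
Qed.

End CyclicTypeI.

Theorem theorem2p11 (F : fieldType) (n : nat) (L : leibnizAlgType F)
    (n_gt0 : (0 < n)%N) (dimL : \dim {:L} = n) (L_typeI : cyclic_typeI L) :
  exists U D : {pred leib_aut L},
    [/\ is_sdprod U D,
        subgroup_iso U (@Igroup F n)
      & subgroup_iso D (predT : {pred runit F})].
Proof.
case: L_typeI => a a_gen; rewrite dimL => a_nil.
exists (unipotent_auts (a := a) n_gt0), (scaling_auts (a := a) n_gt0); split.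
- exact: auts_sdprod.
- exact: unipotent_auts_iso.
- exact: scaling_auts_iso.
Qed.
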